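(* Let $r\ge1$ and $n\ge2r$, and let $A_I=a(X_I)$, $B_I=b(Y_I)$, $I\in\mathcal I_{n,r}$, be the arrays formed from the kernels $a,b$ described in the context. For $0\le k\le r$, $$C_k(A,B)=\sum_{s=k}^r\binom sk\Sigma_s(A,B).$$ Consequently, $$\Sigma_s(A,B)=\sum_{k=s}^r(-1)^{k-s}\binom ks C_k(A,B),\qquad 0\le s\le r.$$
   Context: $(X_i,Y_i)$, $i\ge 1$, are i.i.d. copies of a random pair $(X,Y)$ with values in $\mathcal X\times\mathcal Y$; $a:\mathcal X^r\to\mathbb R$ and $b:\mathcal Y^r\to\mathbb R$ are symmetric kernels with $\mathbb E\{a(X_1,\dots,X_r)^2\}<\infty$ and $\mathbb E\{b(Y_1,\dots,Y_r)^2\}<\infty$. $[n]=\{1,\dots,n\}$; $\binom{[n]}k$ is the set of $k$-element subsets of $[n]$; $\mathcal I_{n,r}=\binom{[n]}r$; for $I=\{i_1<\dots<i_r\}$, $X_I=(X_{i_1},\dots,X_{i_r})$, and similarly $Y_I$. For a real array $A=(A_I)_{I\in\mathcal I_{n,r}}$ and $0\le k\le r$, the $k$-way margin is $(D_{k,r}A)(K)=\sum_{I\in\mathcal I_{n,r},\,I\supseteq K}A_I$, $K\in\binom{[n]}k$. The unnormalized overlap sums and margin cross-products are $$\Sigma_s(A,B)=\sum_{I,J\in\mathcal I_{n,r},\,|I\cap J|=s}A_IB_J,\qquad C_k(A,B)=\sum_{K\in\binom{[n]}k}(D_{k,r}A)(K)\,(D_{k,r}B)(K),$$ the first sum being over ordered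 pairs $(I,J)$. *)

(* Defs.v *)
From HB Require Import structures.
From mathcomp Require Import all_boot all_order all_algebra finmap perm.
From mathcomp Require Import all_classical all_reals all_analysis.
Set Implicit Arguments.
Unset Strict Implicit.
Unset Printing Implicit Defensive.
Import Order.TTheory GRing.Theory Num.Theory.
Local Open Scope classical_set_scope.
Local Open Scope ring_scope.

(* The index set [n] = {1, ..., n} is 'I_n, and a sequence indexed by i >= 1
   is indexed by nat: the item numbered i here is the item i + 1 on paper. *)
Notation ksubset n k := {K : {set 'I_n} | #|K| == k}.

Section arrays.
Context {R : realType} {n r : nat}.
Implicit Types A B : ksubset n r -> R.

Definition margin (k : nat) A (K : ksubset n k) : R :=
  \sum_(I : ksubset n r | val K \subset val I) A I.

Definition overlap_sum (s : nat) A B : R :=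
  \sum_(I : ksubset n r)
    \sum_(J : ksubset n r | #|val I :&: val J| == s) A I * B J.

Definition margin_cross (k : nat) A B : R :=
  \sum_(K : ksubset n k) margin A K * margin B K.

End arrays.

Section kernels.
Context {T : Type} {R : realType} {r : nat}.
Implicit Type a : r.-tuple T -> R.

Definition symmetric_kernel a : Prop :=
  forall (s : 'S_r) (x : r.-tuple T), a [tuple tnth x (s j) | j < r] = a x.

(* enum_val lists the elements of I in increasing order *)
Definition subsample {n : nat} (x : nat -> T) (I : ksubset n r) : r.-tuple T :=
  [tuple x (enum_val (cast_ord (esym (eqP (valP I))) j)) | j < r].

Definition kernel_array {n : nat} a (x : nat -> T) : ksubset n r -> R :=
  fun I => a (subsample x I).

End kernels.

Section iid.
Context d d' (Omega : measurableType d) (T : measurableType d') (R : realType).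
Variable P : probability Omega R.

Definition mutually_independent (Z : nat -> {RV P >-> T}) : Prop :=
  forall (J : {fset nat}) (F : nat -> set T), (forall j, measurable (F j)) ->
    P (\bigcap_(j in [set` J]) (Z j @^-1` F j)) =
    (\prod_(j <- J) P (Z j @^-1` F j))%E.

Definition iid_copies (W : {RV P >-> T}) (Z : nat -> {RV P >-> T}) : Prop :=
  mutually_independent Z /\
  forall i (F : set T), measurable F ->
    distribution P (Z i) F = distribution P W F.

End iid.

(* Main.v *)
(** [C_k] counts each pair [(I, J)] once for every [k]-subset [K] of
    [I] and [J], that is ['C(#|I :&: J|, k)] times; sorting the pairs by
    [#|I :&: J|] gives the first identity, and binomial inversion the second. *)
Require Import Defs.
From HB Require Import structures.
From mathcomp Require Import all_boot all_order all_algebra.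
From mathcomp Require Import zify.
From mathcomp Require Import all_classical all_reals all_analysis.
Import Order.TTheory GRing.Theory Num.Theory.
Local Open Scope classical_set_scope.
Local Open Scope ring_scope.

Lemma card_ksubset_sub (n k : nat) (S : {set 'I_n}) :
  #|[pred K : ksubset n k | val K \subset S]| = 'C(#|S|, k).
Proof.
rewrite -cards_draws -(card_imset _ val_inj); apply: eq_card => K.
rewrite [in RHS]inE; apply/imsetP/andP => [[K' + ->]|[sKS cK]].
  by rewrite inE => ->; split=> //; exact: (valP K').
by exists (Sub K cK); rewrite ?inE ?SubK.
Qed.

Lemma margin_crossE (R : realType) (n r k : nat) (A B : ksubset n r -> R) :
  margin_cross k A B =
  \sum_I \sum_J 'C(#|val I :&: val J|, k)%:R * (A I * B J).
Proof.
rewrite /margin_cross /margin.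
under eq_bigr do rewrite big_mkcond big_distrlr /=.
rewrite exchange_big; apply: eq_bigr => I _.
under eq_bigr do rewrite big_mkcond /=.
rewrite exchange_big; apply: eq_bigr => J _ /=.
(* The binomial is unfolded into a sum of ones over the [K] inside [I :&: J], to be matched term by
   term with the two margin conditions on [K]. *)
rewrite -card_ksubset_sub -sum1_card natr_sum mulr_suml [RHS]big_mkcond.
apply: eq_bigr => K _; rewrite !inE finset.subsetI mul1r.
by case: (val K \subset val I); case: (val K \subset val J);
  rewrite //= ?mul0r.
Qed.

(** Each pair [(I, J)] lies in exactly one overlap class, and its index is at most [r] because
    [I :&: J] sits inside [I]. *)
Lemma sum_overlap_sum (R : realType) (n r : nat) (f : nat -> R)
    (A B : ksubset n r -> R) :
  \sum_(s < r.+1) f s * overlap_sum s A B =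
  \sum_I \sum_J f #|val I :&: val J| * (A I * B J).
Proof.
under eq_bigr do rewrite mulr_sumr.
rewrite exchange_big; apply: eq_bigr => I _.
under eq_bigr do rewrite mulr_sumr big_mkcond.
rewrite exchange_big; apply: eq_bigr => J _ /=.
have ltIr : (#|val I :&: val J| < r.+1)%N.
  by rewrite ltnS -[leqRHS](eqP (valP I)) subset_leq_card ?finset.subsetIl.
by rewrite -big_mkcond (big_pred1 (Ordinal ltIr)).
Qed.

(** Gives nested sums independent ranges, so that they can be exchanged; the added terms will
    contain a vanishing binomial. *)
Lemma big_nat_ord_widen (R : nzRingType) (m p : nat) (F : nat -> R) :
  (forall i, (i < m)%N -> F i = 0) ->
  \sum_(m <= i < p) F i = \sum_(i < p) F i.
Proof.
move=> F0; rewrite big_geq_mkord big_mkcond; apply: eq_bigr => i _ /=.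
by case: leqP => // /F0.
Qed.

(** Multiplied by [s! * (k - s)! * (t - k)!], both sides become [t!]. *)
Lemma bin_trinomial (s k t : nat) : (s <= k <= t)%N ->
  ('C(k, s) * 'C(t, k) = 'C(t, s) * 'C(t - s, k - s))%N.
Proof.
move=> /andP[sk kt]; have st := leq_trans sk kt.
apply/eqP; rewrite -(eqn_pmul2r (fact_gt0 s)) -(eqn_pmul2r (fact_gt0 (k - s))).
rewrite -(eqn_pmul2r (fact_gt0 (t - k))); apply/eqP.
have fk := bin_fact sk; have ft := bin_fact kt; have fs := bin_fact st.
have := bin_fact (leq_sub2r s kt); rewrite subnBA // subnK // => fts.
transitivity t`!; first by rewrite -ft -fk; lia.
by rewrite -fs -fts; lia.
Qed.

(** For [s <= t], [bin_trinomial] pulls out ['C(t, s)] and leaves the binomial expansion of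
    [(1 - 1) ^+ (t - s)]. *)
Lemma bin_orthogonality (R : comNzRingType) (r s t : nat) :
  (t <= r)%N ->
  \sum_(k < r.+1) (-1) ^+ (k - s) * 'C(k, s)%:R * 'C(t, k)%:R
  = (s == t)%:R :> R.
Proof.
pose F k : R := (-1) ^+ (k - s) * 'C(k, s)%:R * 'C(t, k)%:R.
move=> ler; rewrite -(big_mkord xpredT F).
(* The terms with [k > t] vanish through ['C(t, k)]. *)
rewrite (big_cat_nat _ (n := t.+1)) //= [X in _ + X]big_nat_cond.
rewrite [X in _ + X]big1 => [|k /andP[/andP[tk _] _]]; last first.
  by rewrite /F [X in _ * X%:R]bin_small // mulr0.
rewrite addr0; have [ts|le_st] := ltnP t s.
  rewrite gtn_eqF // big_nat_cond big1 // => k /andP[/andP[_ kt] _].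
  by rewrite /F bin_small ?mulr0 ?mul0r //; apply: leq_ltn_trans ts.
(* For [k < s] the truncated exponent [k - s] is [0], but ['C(k, s)] kills the term. *)
rewrite big_mkord -(@big_nat_ord_widen _ s _ F); last first.
  by move=> k ks; rewrite /F bin_small // mulr0 mul0r.
(* At [s = t] this rests on [0 ^+ 0 = 1]. *)
have -> : (s == t)%:R = 'C(t, s)%:R * (1 - 1) ^+ (t - s) :> R.
  rewrite subrr expr0n subn_eq0; have [->|ne] := eqVneq s t.
    by rewrite leqnn binn mul1r.
  by rewrite leqNgt ltn_neqAle ne le_st mulr0.
rewrite exprBn mulr_sumr -{1}[s]add0n big_addn subSn // big_mkord.
apply: eq_bigr => i _; rewrite /F addnK !expr1n !mulr1 -mulrA -natrM.
rewrite bin_trinomial; last by rewrite leq_addl addnC -leq_subRL // -ltnS ltn_ord.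
by rewrite addnK natrM mulrCA [_ ^+ i * _]mulr_natr.
Qed.

Lemma binomial_inversion (R : comNzRingType) (r : nat) (c f : nat -> R) :
  (forall k, (k <= r)%N -> c k = \sum_(k <= s < r.+1) 'C(s, k)%:R * f s) ->
  forall s, (s <= r)%N ->
  f s = \sum_(s <= k < r.+1) (-1) ^+ (k - s) * 'C(k, s)%:R * c k.
Proof.
move=> cE s le_sr; rewrite big_nat_ord_widen => [|k ks]; last first.
  by rewrite bin_small // mulr0 mul0r.
(* Work backwards from [f s]: write it against a Kronecker delta, expand the delta by orthogonality,
   and exchange the sums so that the inner one is [c k]. *)
transitivity (\sum_(t < r.+1) (s == t)%:R * f t).
  rewrite (bigD1 (Ordinal (le_sr : (s < r.+1)%N))) //= eqxx mul1r.
  rewrite big1 ?addr0 // => t; rewrite -val_eqE /= eq_sym => /negPf->.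
  exact: mul0r.
under eq_bigr => t _.
  rewrite -(bin_orthogonality R r s t (ltnSE (ltn_ord t))) mulr_suml; over.
rewrite exchange_big; apply: eq_bigr => k _.
rewrite (cE k (ltnSE (ltn_ord k))) big_nat_ord_widen => [|t tk]; last first.
  by rewrite bin_small // mul0r.
by rewrite mulr_sumr; apply: eq_bigr => t _; rewrite mulrA.
Qed.

Theorem proposition6p2
  (R : realType)
  (d dX dY : measure_display)
  (Omega : measurableType d) (SX : measurableType dX) (SY : measurableType dY)
  (P : probability Omega R)
  (XY : {RV P >-> (SX * SY)%type})
  (Z : nat -> {RV P >-> (SX * SY)%type})
  (hZ : iid_copies XY Z)
  (n r : nat) (hr : (1 <= r)%N) (hn : (2 * r <= n)%N)
  (a : r.-tuple SX -> R) (b : r.-tuple SY -> R)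
  (ma : measurable_fun setT a) (mb : measurable_fun setT b)
  (sa : symmetric_kernel a) (sb : symmetric_kernel b)
  (ha : ('E_P[(fun w => a [tuple (Z i w).1 | i < r] ^+ 2)%R] < +oo)%E)
  (hb : ('E_P[(fun w => b [tuple (Z i w).2 | i < r] ^+ 2)%R] < +oo)%E)
  (w : Omega)
  (A B : ksubset n r -> R)
  (hA : A = kernel_array a (fun i => (Z i w).1))
  (hB : B = kernel_array b (fun i => (Z i w).2)) :
  (forall k : nat, (k <= r)%N ->
     margin_cross k A B
     = \sum_(k <= s < r.+1) 'C(s, k)%:R * overlap_sum s A B) /\
  (forall s : nat, (s <= r)%N ->
     overlap_sum s A B
     = \sum_(s <= k < r.+1) (-1) ^+ (k - s) * 'C(k, s)%:R * margin_cross k A B).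
Proof.
suff CE k : (k <= r)%N ->
    margin_cross k A B
    = \sum_(k <= s < r.+1) 'C(s, k)%:R * overlap_sum s A B.
  by split=> //; exact: binomial_inversion.
(* The weight ['C(s, k)] is the number of [k]-subsets shared by a pair with overlap [s]; it is zero
   for [s < k], which sets the lower limit of the sum. *)
move=> _; rewrite margin_crossE -(sum_overlap_sum _ _ _ (fun s => 'C(s, k)%:R)).
by rewrite big_nat_ord_widen // => s sk; rewrite bin_small // mul0r.
Qed.
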